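(* Let $\mathcal{A}=\{\mathbf{a}^1,\ldots,\mathbf{a}^k\}\subset[0,1]^n$. (i) Let a fuzzy implication $I$ and a fuzzy conjunction $C$ form an adjunction, and let $\mathcal{V}$ be the max-$C$ PAFMM associated with $\mathcal{A}$. Then, for every $\mathbf{x}\in[0,1]^n$, $$\mathcal{V}(\mathbf{x})=\bigvee_{\xi=1}^k C(\lambda_\xi,\mathbf{a}^\xi),\quad\text{where}\quad \lambda_\xi=\bigwedge_{j=1}^n I(a_j^\xi,x_j).$$ (ii) Dually, let a fuzzy disjunction $D$ and a fuzzy co-implication $J$ form an adjunction, and let $\mathcal{S}$ be the min-$D$ PAFMM associated with $\mathcal{A}$. Then, for every $\mathbf{x}\in[0,1]^n$, $$\mathcal{S}(\mathbf{x})=\bigwedge_{\xi=1}^k D(\theta_\xi,\mathbf{a}^\xi),\quad\text{where}\quad \theta_\xi=\bigvee_{j=1}^n J(a_j^\xi,x_j).$$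
   Context: All connectives are mappings $[0,1]\times[0,1]\to[0,1]$. A fuzzy conjunction $C$ is nondecreasing in both arguments with $C(0,0)=C(0,1)=C(1,0)=0$, $C(1,1)=1$. A fuzzy disjunction $D$ is nondecreasing in both arguments with $D(0,0)=0$, $D(0,1)=D(1,0)=D(1,1)=1$. A fuzzy implication $I$ is nonincreasing in the first and nondecreasing in the second argument with $I(0,0)=I(0,1)=I(1,1)=1$, $I(1,0)=0$. A fuzzy co-implication $J$ is nonincreasing in the first and nondecreasing in the second argument with $J(0,0)=J(1,0)=J(1,1)=0$, $J(0,1)=1$. $I$ and $C$ form an adjunction if for all $a,x,y\in[0,1]$: $I(a,x)\geq y\Longleftrightarrow x\geq C(y,a)$. $D$ and $J$ form an adjunction if for all $a,x,y\in[0,1]$: $J(a,x)\leq y\Longleftrightarrow x\leq D(y,a)$. Vectors in $[0,1]^n$ are ordered componentwise; $\bigvee$ and $\bigwedge$ of vectors are componentwise supremum and infimum. For $\lambda\in[0,1]$ and $\mathbf{a}\in[0,1]^n$, $C(\lambda,\mathbf{a})$ is the vector with components $C(\lambda,a_i)$; similarly for $D(\theta,\mathbf{a})$. The sets of all max-$C$ and min-$D$ combinations of $\mathcal{A}=\{\mathbf{a}^1,\ldots,\mathbf{a}^k\}$ are $$\mathcal{C}(\mathcal{A})=\Big\{\bigvee_{\xi=1}^k C(\lambda_\xi,\mathbf{a}^\xi):\lambda_\xi\in[0,1]\Big\},\qquad \mathcal{D}(\mathcal{A})=\Big\{\bigwedge_{\xi=1}^k D(\theta_\xi,\mathbf{a}^\xi):\theta_\xi\in[0,1]\Big\}.$$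 The max-$C$ projection autoassociative fuzzy morphological memory (max-$C$ PAFMM) $\mathcal{V}$ and the min-$D$ PAFMM $\mathcal{S}$ associated with $\mathcal{A}$ are the maps $[0,1]^n\to[0,1]^n$ defined by $$\mathcal{V}(\mathbf{x})=\bigvee\{\mathbf{z}\in\mathcal{C}(\mathcal{A}):\mathbf{z}\leq\mathbf{x}\},\qquad \mathcal{S}(\mathbf{x})=\bigwedge\{\mathbf{y}\in\mathcal{D}(\mathcal{A}):\mathbf{y}\geq\mathbf{x}\}.$$ *)

(* Defs.v *)
From mathcomp Require Import all_boot all_order all_algebra.
From mathcomp Require Import interval_inference all_classical all_reals.

Set Implicit Arguments.
Unset Strict Implicit.
Unset Printing Implicit Defensive.

Import Order.TTheory GRing.Theory Num.Theory.

Local Open Scope classical_set_scope.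
Local Open Scope ring_scope.

Section Connectives.
Variable R : realType.
Implicit Types C D I J : {i01 R} -> {i01 R} -> {i01 R}.

Record fuzzy_conjunction C : Prop := FuzzyConjunction {
  conj_homol : forall y, {homo C^~ y : x1 x2 / x1 <= x2} ;
  conj_homor : forall x, {homo C x : y1 y2 / y1 <= y2} ;
  conj00 : C 0%:i01 0%:i01 = 0%:i01 ;
  conj01 : C 0%:i01 1%:i01 = 0%:i01 ;
  conj10 : C 1%:i01 0%:i01 = 0%:i01 ;
  conj11 : C 1%:i01 1%:i01 = 1%:i01 }.

Record fuzzy_disjunction D : Prop := FuzzyDisjunction {
  disj_homol : forall y, {homo D^~ y : x1 x2 / x1 <= x2} ;
  disj_homor : forall x, {homo D x : y1 y2 / y1 <= y2} ;
  disj00 : D 0%:i01 0%:i01 = 0%:i01 ;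
  disj01 : D 0%:i01 1%:i01 = 1%:i01 ;
  disj10 : D 1%:i01 0%:i01 = 1%:i01 ;
  disj11 : D 1%:i01 1%:i01 = 1%:i01 }.

Record fuzzy_implication I : Prop := FuzzyImplication {
  impl_antil : forall y, {homo I^~ y : x1 x2 /~ x1 <= x2} ;
  impl_homor : forall x, {homo I x : y1 y2 / y1 <= y2} ;
  impl00 : I 0%:i01 0%:i01 = 1%:i01 ;
  impl01 : I 0%:i01 1%:i01 = 1%:i01 ;
  impl11 : I 1%:i01 1%:i01 = 1%:i01 ;
  impl10 : I 1%:i01 0%:i01 = 0%:i01 }.

Record fuzzy_coimplication J : Prop := FuzzyCoimplication {
  coimpl_antil : forall y, {homo J^~ y : x1 x2 /~ x1 <= x2} ;
  coimpl_homor : forall x, {homo J x : y1 y2 / y1 <= y2} ;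
  coimpl00 : J 0%:i01 0%:i01 = 0%:i01 ;
  coimpl10 : J 1%:i01 0%:i01 = 0%:i01 ;
  coimpl11 : J 1%:i01 1%:i01 = 0%:i01 ;
  coimpl01 : J 0%:i01 1%:i01 = 1%:i01 }.

Definition adjunction_impl_conj I C : Prop :=
  forall a x y, I a x >= y <-> x >= C y a.

Definition adjunction_disj_coimpl D J : Prop :=
  forall a x y, J a x <= y <-> x <= D y a.

End Connectives.

(* The order (z <= x)%O on 'I_n -> {i01 R} below is the pointwise one.
   Suprema and infima are those of the complete lattice [0, 1]: the empty
   supremum is 0 and the empty infimum is 1, as the default values record. *)
Section ProjectionMemories.
Variables (R : realType) (n k : nat).
Implicit Types (C D : {i01 R} -> {i01 R} -> {i01 R}).
Implicit Types (S : set ('I_n -> {i01 R})) (x : 'I_n -> {i01 R}).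
Implicit Types (a : 'I_k -> 'I_n -> {i01 R}).

Definition vsup S : 'I_n -> {i01 R} :=
  fun i => supremum 0%:i01 [set z i | z in S].

Definition vinf S : 'I_n -> {i01 R} :=
  fun i => infimum 1%:i01 [set z i | z in S].

Definition max_comb C a (lambda : 'I_k -> {i01 R}) : 'I_n -> {i01 R} :=
  fun i => \big[Order.max/0%:i01]_(xi < k) C (lambda xi) (a xi i).

Definition min_comb D a (theta : 'I_k -> {i01 R}) : 'I_n -> {i01 R} :=
  fun i => \big[Order.min/1%:i01]_(xi < k) D (theta xi) (a xi i).

Definition max_combs C a : set ('I_n -> {i01 R}) := range (max_comb C a).

Definition min_combs D a : set ('I_n -> {i01 R}) := range (min_comb D a).

Definition max_PAFMM C a x : 'I_n -> {i01 R} :=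
  vsup [set z | max_combs C a z /\ (z <= x)%O].

Definition min_PAFMM D a x : 'I_n -> {i01 R} :=
  vinf [set y | min_combs D a y /\ (y >= x)%O].

End ProjectionMemories.

(* [0, 1] is a complete lattice, so the default values above only matter on
   the empty set. *)
Section CompleteLattice.
Variable R : realType.
Implicit Types A : set {i01 R}.

Lemma i01_supremumP A : supremums A (supremum 0%:i01 A).
Proof.
have num0 (x : {i01 R}) : 0 <= x%:num by [].
have num1 (x : {i01 R}) : x%:num <= 1 by [].
have [->|A0] := eqVneq A set0.
  by rewrite supremum0; split=> [? []//|y _]; exact: num0.
have [a Aa] := (set0P A).1 A0.
have Bsup : has_sup [set x%:num | x in A].
  by split; [exists a%:num, a | exists 1 => _ [x _ <-]].
have s0 : 0 <= sup [set x%:num | x in A].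
  by apply: le_trans (num0 a) _; apply: ub_le_sup; [case: Bsup | exists a].
have s1 : sup [set x%:num | x in A] <= 1.
  by apply: ge_sup; [case: Bsup | move=> _ [x _ <-]].
rewrite /supremum (negPf A0); apply: xgetPex.
exists (Itv01 s0 s1); split=> [x Ax|y Ay].
  by rewrite -num_le /=; apply: ub_le_sup; [case: Bsup | exists x].
rewrite -num_le /=; apply: ge_sup; first by case: Bsup.
by move=> _ [x Ax <-]; rewrite num_le; exact: Ay.
Qed.

Lemma i01_infimumP A : infimums A (infimum 1%:i01 A).
Proof.
have num0 (x : {i01 R}) : 0 <= x%:num by [].
have num1 (x : {i01 R}) : x%:num <= 1 by [].
have [->|A0] := eqVneq A set0.
  by rewrite /infimum eqxx; split=> [? []//|y _]; exact: num1.
have [a Aa] := (set0P A).1 A0.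
have Binf : has_inf [set x%:num | x in A].
  by split; [exists a%:num, a | exists 0 => _ [x _ <-]].
have s0 : 0 <= inf [set x%:num | x in A].
  by apply: lb_le_inf; [case: Binf | move=> _ [x _ <-]].
have s1 : inf [set x%:num | x in A] <= 1.
  by apply: le_trans (num1 a); apply: ge_inf; [case: Binf | exists a].
rewrite /infimum (negPf A0); apply: xgetPex.
exists (Itv01 s0 s1); split=> [x Ax|y Ay].
  by rewrite -num_le /=; apply: ge_inf; [case: Binf | exists x].
rewrite -num_le /=; apply: lb_le_inf; first by case: Binf.
by move=> _ [x Ax <-]; rewrite num_le; exact: Ay.
Qed.

End CompleteLattice.

(* Main.v *)
(** The adjunction turns the condition [max_comb C a mu <= x] into the
componentwise bound [mu <= lambda], where [lambda] is the vector of meets in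
the statement.  Hence [lambda] itself is admissible, and, since [C] is
nondecreasing in its first argument, it yields the greatest combination below
[x], which is therefore the supremum.  The second half is order-dual. *)
Require Import Defs.
From mathcomp Require Import all_boot all_order all_algebra.
From mathcomp Require Import interval_inference all_classical all_reals.
Local Open Scope ring_scope.

Import Order.TTheory Num.Theory.

Section ProjectionMemories.
Context {R : realType} {n k : nat}.
Implicit Types (C D I J : {i01 R} -> {i01 R} -> {i01 R}).
Implicit Types (S : set ('I_n -> {i01 R})) (x z : 'I_n -> {i01 R}).
Implicit Types (a : 'I_k -> 'I_n -> {i01 R}) (mu nu : 'I_k -> {i01 R}).

Lemma i01_ge0 (t : {i01 R}) : 0%:i01 <= t.
Proof. by rewrite -num_le /=. Qed.

Lemma i01_le1 (t : {i01 R}) : t <= 1%:i01.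
Proof. by rewrite -num_le /=. Qed.

(** A greatest element [z] attains the supremum in all coordinates at once, so the theorem needs
    only an admissible combination that dominates the others. *)
Lemma vsup_greatest S z :
  S z -> (forall w, S w -> (w <= z)%O) -> vsup S = z.
Proof.
move=> Sz zS; apply/funext => i; apply/le_anti.
have [ubS lubS] := i01_supremumP [set w i | w in S]%classic.
apply/andP; split; last by apply: ubS; exists z.
by apply: lubS => _ [w /zS /lefP wz <-].
Qed.

Lemma vinf_least S z :
  S z -> (forall w, S w -> (z <= w)%O) -> vinf S = z.
Proof.
move=> Sz zS; apply/funext => i; apply/le_anti.
have [lbS glbS] := i01_infimumP [set w i | w in S]%classic.
apply/andP; split; first by apply: lbS; exists z.
by apply: glbS => _ [w /zS /lefP wz <-].
Qed.

Lemma max_comb_leP C a mu x :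
  (max_comb C a mu <= x)%O <-> forall xi j, C (mu xi) (a xi j) <= x j.
Proof.
split=> [/lefP le_x xi j|le_x]; last first.
  (* The initial value [0] of the maximum has to lie below [x j] as well. *)
  by apply/lefP => j; apply: bigmax_le => // *; exact: i01_ge0.
by have /bigmax_leP[_ ->] := le_x j.
Qed.

Lemma min_comb_geP D a mu x :
  (x <= min_comb D a mu)%O <-> forall xi j, x j <= D (mu xi) (a xi j).
Proof.
split=> [/lefP ge_x xi j|ge_x]; last first.
  by apply/lefP => j; apply: le_bigmin => // *; exact: i01_le1.
by have /bigmin_geP[_ ->] := ge_x j.
Qed.

(** For fixed [xi], the adjunction turns each condition on [C (mu xi) (a xi j)] into an upper bound
    on [mu xi], and the bounds over all [j] merge into one meet. For [n = 0] no condition remains,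
    which matches the initial value [1]. *)
Lemma max_comb_adjunction I C a mu x : adjunction_impl_conj I C ->
  (max_comb C a mu <= x)%O <->
  forall xi, mu xi <= \big[Order.min/1%:i01]_(j < n) I (a xi j) (x j).
Proof.
move=> adj; rewrite max_comb_leP; split=> [le_x xi|le_mu xi j].
  by apply: le_bigmin => [|j _]; [exact: i01_le1 | exact/adj].
by apply/adj; have /bigmin_geP[_ ->] := le_mu xi.
Qed.

Lemma min_comb_adjunction D J a mu x : adjunction_disj_coimpl D J ->
  (x <= min_comb D a mu)%O <->
  forall xi, \big[Order.max/0%:i01]_(j < n) J (a xi j) (x j) <= mu xi.
Proof.
move=> adj; rewrite min_comb_geP; split=> [ge_x xi|ge_mu xi j].
  by apply: bigmax_le => [|j _]; [exact: i01_ge0 | exact/adj].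
by apply/adj; have /bigmax_leP[_ ->] := ge_mu xi.
Qed.

Lemma max_comb_homo C a mu nu : fuzzy_conjunction C ->
  (forall xi, mu xi <= nu xi) -> (max_comb C a mu <= max_comb C a nu)%O.
Proof.
move=> fC le_mn; apply/lefP => i.
by apply: le_bigmax2 => xi _; exact: conj_homol.
Qed.

Lemma min_comb_homo D a mu nu : fuzzy_disjunction D ->
  (forall xi, mu xi <= nu xi) -> (min_comb D a mu <= min_comb D a nu)%O.
Proof.
move=> fD le_mn; apply/lefP => i.
by apply: le_bigmin2 => xi _; exact: disj_homol.
Qed.

End ProjectionMemories.

Theorem theorem3 (R : realType) (n k : nat) (a : 'I_k -> 'I_n -> {i01 R}) :
  (forall I C : {i01 R} -> {i01 R} -> {i01 R},
     fuzzy_implication I -> fuzzy_conjunction C -> adjunction_impl_conj I C ->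
     forall x : 'I_n -> {i01 R},
       max_PAFMM C a x =
       max_comb C a
         (fun xi => \big[Order.min/1%:i01]_(j < n) I (a xi j) (x j)))
  /\
  (forall D J : {i01 R} -> {i01 R} -> {i01 R},
     fuzzy_disjunction D -> fuzzy_coimplication J ->
     adjunction_disj_coimpl D J ->
     forall x : 'I_n -> {i01 R},
       min_PAFMM D a x =
       min_comb D a
         (fun xi => \big[Order.max/0%:i01]_(j < n) J (a xi j) (x j))).
Proof.
split=> [I C _ fC adj x|D J fD _ adj x].
- apply: vsup_greatest => [|_ [[mu _ <-]] /(max_comb_adjunction _ _ _ _ _ adj)].
    (* The witness is the vector of meets itself: with it as [mu], the bound to check is
       reflexivity. *)
    by split; [eexists | exact/(max_comb_adjunction _ _ _ _ _ adj)].
  exact: max_comb_homo.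
- apply: vinf_least => [|_ [[mu _ <-]] /(min_comb_adjunction _ _ _ _ _ adj)].
    by split; [eexists | exact/(min_comb_adjunction _ _ _ _ _ adj)].
  (* An admissible [mu] lies above the joins, so their combination is the least one. *)
  exact: min_comb_homo.
Qed.
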